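(* Let $X$ be a finite set and let $\mathrm{FIM}_X$ be the free inverse monoid generated by $X$. Then $\mathcal{H}\text{-}\mathrm{Geo}(\mathrm{FIM}_X)=\mathrm{Geo}(\mathrm{FIM}_X)$ is a co-context-free language.
   Context: $\tilde X=X\cup X^{-1}$ with $X^{-1}=\{x^{-1}:x\in X\}$ a disjoint copy of $X$; $\pi:\tilde X^*\to \mathrm{FIM}_X$ is the canonical surjective homomorphism; $\ell(w)$ is the length of the word $w$. With $\mathcal{H}$ Green's relation on $\mathrm{FIM}_X$, $$\mathcal{H}\text{-}\mathrm{Geo}(\mathrm{FIM}_X)=\bigl\{w\in\tilde X^*: \ell(w)=\min\{\ell(u): u\in\tilde X^*,\ (u\pi)\,\mathcal{H}\,(w\pi)\}\bigr\},$$ $$\mathrm{Geo}(\mathrm{FIM}_X)=\bigl\{w\in\tilde X^*: \ell(w)=\min\{\ell(u): u\in\tilde X^*,\ u\pi=w\pi\}\bigr\}.$$ A language $K\subseteq\tilde X^*$ is co-context-free if its complement $\tilde X^*\setminus K$ is context-free. *)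

(* Defs.v *)
From HB Require Import structures.
From mathcomp Require Import all_boot.
From mathcomp Require Import boolp classical_sets.
From Stdlib Require Import Relations.Relation_Operators.

Set Implicit Arguments.
Unset Strict Implicit.
Unset Printing Implicit Defensive.

Local Open Scope classical_set_scope.
Local Open Scope quotient_scope.
Local Open Scope group_scope.

(* [inl x] is the generator [x] and [inr x] its formal inverse. *)
Notation letter X := (X + X)%type.
Notation word X := (seq (letter X)).

Definition letter_inv (X : Type) (a : letter X) : letter X :=
  match a with inl x => inr x | inr x => inl x end.

Definition word_inv (X : Type) (w : word X) : word X :=
  rev (map (@letter_inv X) w).

(* The Vagner congruence: the least congruence on the free monoid with
   involution whose quotient is an inverse monoid. *)
Inductive vagner (X : Type) : word X -> word X -> Prop :=
| vagner_regular u : vagner (u ++ word_inv u ++ u) u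
| vagner_comm u v :
    vagner (u ++ word_inv u ++ v ++ word_inv v)
           (v ++ word_inv v ++ u ++ word_inv u)
| vagner_refl u : vagner u u
| vagner_sym u v : vagner u v -> vagner v u
| vagner_trans v u w : vagner u v -> vagner v w -> vagner u w
| vagner_cat u u' v v' :
    vagner u u' -> vagner v v' -> vagner (u ++ v) (u' ++ v').

Section FreeInverseMonoid.
Variable X : finType.

Definition vagnerb : rel (word X) := fun u v => `[< vagner u v >].

Lemma vagnerb_refl : reflexive vagnerb.
Proof. by move=> u; apply/asboolP; exact: vagner_refl. Qed.

Lemma vagnerb_sym : symmetric vagnerb.
Proof. by move=> u v; apply/asboolP/asboolP; exact: vagner_sym. Qed.

Lemma vagnerb_trans : transitive vagnerb.
Proof.
move=> v u w /asboolP uv /asboolP vw; apply/asboolP.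
exact: vagner_trans uv vw.
Qed.

Canonical vagner_equiv :=
  EquivRel vagnerb vagnerb_refl vagnerb_sym vagnerb_trans.

Definition FIM := {eq_quot vagner_equiv}.

HB.instance Definition _ := Choice.on FIM.
HB.instance Definition _ := EqQuotient.on FIM.

Definition FIM_pi (w : word X) : FIM := \pi_FIM w.

Lemma FIM_piP u v : FIM_pi u = FIM_pi v <-> vagner u v.
Proof.
by split=> [/eqmodP /asboolP|uv] //; apply/eqmodP/asboolP.
Qed.

Lemma FIM_pi_surj (x : FIM) : exists w, FIM_pi w = x.
Proof. by exists (repr x); rewrite /FIM_pi reprK. Qed.

Definition FIM_mul (x y : FIM) : FIM := FIM_pi (repr x ++ repr y).

Lemma FIM_mul_pi u v : FIM_mul (FIM_pi u) (FIM_pi v) = FIM_pi (u ++ v).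
Proof.
by apply/FIM_piP/vagner_cat; apply/FIM_piP; rewrite /FIM_pi reprK.
Qed.

Lemma FIM_mulA : associative FIM_mul.
Proof.
move=> x y z.
have [[u <-] [v <-] [w <-]] := And3 (FIM_pi_surj x) (FIM_pi_surj y)
  (FIM_pi_surj z).
by rewrite !FIM_mul_pi catA.
Qed.

Lemma FIM_mul1 : left_id (FIM_pi [::]) FIM_mul.
Proof. by move=> x; have [u <-] := FIM_pi_surj x; rewrite FIM_mul_pi. Qed.

Lemma FIM_mulr1 : right_id (FIM_pi [::]) FIM_mul.
Proof.
by move=> x; have [u <-] := FIM_pi_surj x; rewrite FIM_mul_pi cats0.
Qed.

HB.instance Definition _ := isMonoid.Build FIM FIM_mulA FIM_mul1 FIM_mulr1.

Lemma FIM_pi_cat u v : FIM_pi (u ++ v) = (FIM_pi u * FIM_pi v : FIM).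
Proof. by rewrite -FIM_mul_pi. Qed.

Lemma FIM_pi_nil : FIM_pi [::] = (1 : FIM).
Proof. by []. Qed.

End FreeInverseMonoid.

Definition green_L (M : monoidType) (a b : M) : Prop :=
  range (fun x : M => x * a) = range (fun x : M => x * b).

Definition green_R (M : monoidType) (a b : M) : Prop :=
  range (fun x : M => a * x) = range (fun x : M => b * x).

Definition green_H (M : monoidType) (a b : M) : Prop :=
  green_L a b /\ green_R a b.

Definition is_min (S : set nat) (n : nat) : Prop :=
  S n /\ forall m, S m -> n <= m.

Definition Geo (X : finType) : set (word X) :=
  [set w | is_min [set size u | u in [set u | FIM_pi u = FIM_pi w]] (size w)].

Definition HGeo (X : finType) : set (word X) :=
  [set w | is_min [set size u | u in [set u | green_H (FIM_pi u) (FIM_pi w)]]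
                  (size w)].

Arguments Geo : clear implicits.
Arguments HGeo : clear implicits.

Record cfg (T : finType) := Cfg {
  cfg_nonterm : finType;
  cfg_start : cfg_nonterm;
  cfg_rules : seq (cfg_nonterm * seq (cfg_nonterm + T))
}.

Inductive cfg_step (T : finType) (G : cfg T) :
  seq (cfg_nonterm G + T) -> seq (cfg_nonterm G + T) -> Prop :=
| CfgStep l r A rhs : (A, rhs) \in cfg_rules G ->
    cfg_step (l ++ inl A :: r) (l ++ rhs ++ r).

Definition cfg_lang (T : finType) (G : cfg T) : set (seq T) :=
  [set w | clos_refl_trans _ (@cfg_step T G)
             [:: inl (cfg_start G)] (map inr w)].

Definition context_free (T : finType) (L : set (seq T)) : Prop :=
  exists G : cfg T, cfg_lang G = L.

Definition co_context_free (T : finType) (L : set (seq T)) : Prop :=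
  context_free (~` L).

(* Main.v *)
Require Import Defs.
From HB Require Import structures.
From mathcomp Require Import all_boot.
From mathcomp Require Import boolp classical_sets.
From Stdlib Require Import Relations.Relation_Operators.

(** A word read from the identity traces a walk in the Cayley graph of the free
    group, which is a tree.  The edges crossed (the Munn tree) and the endpoint
    depend only on the element of the free inverse monoid that the word
    represents ([vagner_invariant]).  In a tree, the parity of the number of
    crossings of an edge is fixed by the endpoints of the walk
    ([odd_crossings]).  So a walk that crosses no edge three times, hence every
    edge of its tree once or twice, crosses each edge as rarely as any walk with
    the same tree and endpoint can: it is a geodesic.

    If some edge is crossed three times, consecutive crossings have opposite
    directions, so the word contains a factor [a q a^-1 r a] where [q] and [r]
    are trivial in the free group, that is, are Dyck words ([closed_dyck]).
    Dyck words represent idempotents, these commute, and the factor is equal in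
    the free inverse monoid to [r a q], which has two letters fewer
    ([thrice_shorten]).  Hence the words that are not geodesic are exactly the
    words with such a factor ([not_Geo_crosses_thrice]), and a grammar with
    three nonterminals generates these.

    The two notions of geodesic agree because the relation H is trivial
    ([green_H_FIM]).  If [y = x w = t x] and [x] is a right multiple of [y],
    then every [x w^n] is R-related to [x], so the walk of [x w^n] stays in the
    finite tree of [x].  Powers of a nontrivial element of a free group have
    unbounded length, so [w] is trivial in the free group and represents an
    idempotent.  Thus [x] and [y] are obtained from one another by multiplying
    on the right by idempotents, which forces [x = y]. *)
Set Implicit Arguments.
Unset Strict Implicit.
Unset Printing Implicit Defensive.

Lemma letter_invK (X : Type) : involutive (@letter_inv X).
Proof. by case. Qed.

Lemma letter_inv_neq (X : eqType) (a : letter X) : a != letter_inv a.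
Proof. by case: a. Qed.

Lemma word_inv_cons (X : Type) (a : letter X) w :
  word_inv (a :: w) = word_inv w ++ [:: letter_inv a].
Proof. by rewrite /word_inv /= rev_cons cats1. Qed.

Lemma word_inv_cat (X : Type) (u v : word X) :
  word_inv (u ++ v) = word_inv v ++ word_inv u.
Proof. by rewrite /word_inv map_cat rev_cat. Qed.

(** * Walks in the Cayley tree of the free group *)
Section CayleyTree.
Variable X : eqType.
Implicit Types (a b : letter X) (c h k p q r s t u v w : word X).

(** A vertex is a reduced word stored as a stack, last letter first: moving
    along a letter acts on the head, and the ancestors of a vertex in the tree
    rooted at the identity are its suffixes. *)
Definition push h a :=
  if ohead h == Some (letter_inv a) then behead h else a :: h.

Definition run h w := foldl push h w.

Definition no_cancel a b := a != letter_inv b.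

Definition reduced h := sorted no_cancel h.

(** An edge is named by its endpoint farther from the root. *)
Definition edge h a := if ohead h == Some (letter_inv a) then h else a :: h.

Fixpoint edges h w :=
  if w is a :: w' then edge h a :: edges (push h a) w' else [::].

Variant push_spec h a : word X -> word X -> Prop :=
  | PushCancel t of h = letter_inv a :: t : push_spec h a t h
  | PushGrow of ohead h != Some (letter_inv a) :
      push_spec h a (a :: h) (a :: h).

Lemma pushP h a : push_spec h a (push h a) (edge h a).
Proof.
rewrite /push /edge; case: ifP => [|/negbT]; last by right.
by case: h => // b t /eqP[->]; left.
Qed.

Lemma run_cat h u v : run h (u ++ v) = run (run h u) v.
Proof. exact: foldl_cat. Qed.

Lemma edges_cat h u v : edges h (u ++ v) = edges h u ++ edges (run h u) v.
Proof. by elim: u h => //= a u IH h; rewrite IH. Qed.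

Lemma size_edges h w : size (edges h w) = size w.
Proof. by elim: w h => //= a w IH h; rewrite IH. Qed.

Lemma push_reduced h a : reduced h -> reduced (push h a).
Proof.
case: pushP => [t ->|]; first exact: path_sorted.
case: h => //= b t ne ->; rewrite andbT; apply: contra ne => /eqP ab.
by rewrite ab letter_invK.
Qed.

Lemma run_reduced h w : reduced h -> reduced (run h w).
Proof. by elim: w h => //= a w IH h /push_reduced/IH. Qed.

Lemma pushK h a : reduced h -> push (push h a) (letter_inv a) = h.
Proof.
case: (pushP h a) => [t ->|_ _]; last by rewrite /push /= letter_invK eqxx.
rewrite /push letter_invK; case: t => //= b t /andP[ne _].
by case: eqP => // -[ba]; rewrite /no_cancel ba eqxx in ne.
Qed.

Lemma edge_push h a : reduced h -> edge (push h a) (letter_inv a) = edge h a.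
Proof.
case: (pushP h a) => [t ->|_ _]; last by rewrite /edge /= letter_invK eqxx.
rewrite /edge letter_invK; case: t => //= b t /andP[ne _].
by case: eqP => // -[ba]; rewrite /no_cancel ba eqxx in ne.
Qed.

Lemma run_word_inv h w : reduced h -> run (run h w) (word_inv w) = h.
Proof.
elim: w h => //= a w IH h hr.
by rewrite word_inv_cons run_cat IH ?push_reduced //= pushK.
Qed.

Lemma edges_word_inv h w :
  reduced h -> edges (run h w) (word_inv w) = rev (edges h w).
Proof.
elim: w h => //= a w IH h hr.
rewrite word_inv_cons edges_cat IH ?push_reduced //= run_word_inv.
  by rewrite edge_push // rev_cons cats1.
exact: push_reduced.
Qed.

Lemma suffix_cons_eq c a h : suffix c (a :: h) = (c == a :: h) || suffix c h.
Proof.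
apply/idP/idP => [/suffixP[[|b t] /= e]|/orP[/eqP->|]].
- by rewrite e eqxx.
- by case: e => _ ->; rewrite suffix_suffix orbT.
- exact: suffix_refl.
- by move=> /suffix_trans; apply; exact: suffix_cons.
Qed.

Lemma suffix_consF a h : suffix (a :: h) h = false.
Proof. by apply/negP => /size_suffix /=; rewrite ltnn. Qed.

(** A step crosses the edge below [c] exactly when it enters or leaves the
    subtree of descendants of [c]. *)
Lemma suffix_push c h a :
  (edge h a == c) = suffix c h (+) suffix c (push h a).
Proof.
case: pushP => [t ->|_]; rewrite suffix_cons_eq eq_sym;
  by case: eqP => [->|] /=; rewrite ?suffix_consF ?addbb.
Qed.

(** Removing an edge separates a tree in two parts; the parity of the crossings
    says whether the walk ends in the part where it started. *)
Lemma odd_crossings c h w :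
  odd (count_mem c (edges h w)) = suffix c h (+) suffix c (run h w).
Proof.
elim: w h => [|a w IH] h /=; first by rewrite addbb.
by rewrite oddD IH oddb suffix_push -addbA addKb.
Qed.

(** An edge has one endpoint on each of its sides, so a second crossing that
    starts on the side reached by the first one is its reversal. *)
Lemma cross_back h k a b :
  edge k b = edge h a ->
  suffix (edge h a) k = suffix (edge h a) (push h a) ->
  k = push h a /\ b = letter_inv a.
Proof.
case: (pushP h a) => [t ->|_]; case: (pushP k b) => [t' ->|_].
- by move=> ->; rewrite suffix_refl suffix_consF.
- by move=> [-> ->].
- by move=> [<- <-]; rewrite letter_invK.
- by move=> <-; rewrite suffix_refl suffix_consF.
Qed.

Lemma first_crossing c h w :
  c \in edges h w ->
  exists p a s, [/\ w = p ++ a :: s, edge (run h p) a = c & c \notin edges h p].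
Proof.
elim: w h => //= a w IH h; rewrite inE.
have [-> _|ne /= /IH [p [b [s [-> eb np]]]]] := eqVneq c (edge h a).
  by exists [::], a, w.
by exists (a :: p), b, s; rewrite /= inE negb_or ne.
Qed.

(** Between two consecutive crossings of an edge the walk stays on one side of
    it, so it comes back to the endpoint where the first crossing left it.
    The last equation lets one count the later crossings. *)
Lemma return_crossing h a w :
  reduced h -> edge h a \in edges (push h a) w ->
  exists q s, [/\ w = q ++ letter_inv a :: s, run (push h a) q = push h a,
    edge h a \notin edges (push h a) q
    & edges (push h a) w
      = edges (push h a) q ++ edge h a :: edges h s].
Proof.
move=> hr /first_crossing[q [b [s [-> eb nq]]]].
have /(cross_back eb)[kq eqb] :
    suffix (edge h a) (run (push h a) q) = suffix (edge h a) (push h a).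
  have := odd_crossings (edge h a) (push h a) q.
  by rewrite (count_memPn nq); do 2!case: suffix.
exists q, s; rewrite -eqb; split=> //.
by rewrite edges_cat /= eb kq eqb pushK.
Qed.

(** The two-sided Dyck language: the words trivial in the free group.
    Splitting at the letter that closes the first one gives a derivation that
    follows both the grammar and the walk. *)
Inductive dyck : word X -> Prop :=
| dyck_nil : dyck [::]
| dyck_cons a p q : dyck p -> dyck q -> dyck (a :: p ++ letter_inv a :: q).

(** A closed walk crosses its first edge an even number of times, hence again;
    the next crossing of that edge goes backwards and cuts the walk into two
    shorter closed walks. *)
Lemma closed_dyck h w : reduced h -> run h w = h -> dyck w.
Proof.
elim: {w}(size w) {-2}w (leqnn (size w)) h => [|n IH] [|a w] //=.
- by move=> *; exact: dyck_nil.
- by move=> *; exact: dyck_nil.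
rewrite ltnS => sw h hr hw.
have : edge h a \in edges (push h a) w.
  have := odd_crossings (edge h a) h (a :: w).
  rewrite [run _ _]hw addbb /= eqxx oddD /= -has_pred1 has_count.
  by case: count.
case/(return_crossing hr) => q [s [ew kq _ _]].
move: sw hw; rewrite ew size_cat /= => sw.
rewrite run_cat kq /= pushK // => hs.
apply: dyck_cons.
  by apply: IH (push_reduced a hr) kq; rewrite (leq_trans _ sw) ?leq_addr.
by apply: IH hr hs; rewrite (leq_trans _ sw) // addnS ltnW // ltnS leq_addl.
Qed.

Definition crosses_thrice w :=
  exists p a q r s, [/\ w = p ++ a :: q ++ letter_inv a :: r ++ a :: s,
    dyck q & dyck r].

Lemma count_crosses_thrice c h w :
  reduced h -> 2 < count_mem c (edges h w) -> crosses_thrice w.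
Proof.
move=> hr c3.
have /first_crossing[p [a [s [ew ea np]]]] : c \in edges h w.
  by rewrite -has_pred1 has_count (leq_trans _ c3).
have kr := run_reduced p hr.
move: c3; rewrite ew edges_cat count_cat (count_memPn np) /= ea eqxx add0n.
rewrite add1n ltnS => c2; set k := run h p in ea kr c2.
have : edge k a \in edges (push k a) s.
  by rewrite ea -has_pred1 has_count (leq_trans _ c2).
case/(return_crossing kr) => q [s1 [es kq nq eq_s]].
move: c2; rewrite eq_s count_cat -ea (count_memPn nq) /= eqxx add0n add1n.
rewrite ltnS -has_count has_pred1 => ks1.
have k1r := push_reduced a kr.
have := return_crossing (a := letter_inv a) k1r.
rewrite edge_push // pushK // => /(_ _ ks1)[r [s2 [es1 kr' _ _]]].
exists p, a, q, r, s2; rewrite es es1 letter_invK; split=> //.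
  exact: closed_dyck kq.
exact: closed_dyck kr'.
Qed.

(** Asking for invariance from every starting vertex makes compatibility with
    concatenation immediate.  The starting vertex has to be reduced for
    [word_inv] to retrace a walk. *)
Lemma vagner_invariant u v : vagner u v ->
  forall h, reduced h -> run h u = run h v /\ edges h u =i edges h v.
Proof.
elim=> {u v} [u|u v|u|u v _ IH|u v w _ IH1 _ IH2|u u' v v' _ IHu _ IHv] h hr.
- rewrite !run_cat run_word_inv //; split=> // c.
  rewrite !edges_cat run_word_inv // edges_word_inv // !mem_cat mem_rev.
  by rewrite !orbb.
- rewrite !run_cat !run_word_inv //; split=> // c.
  rewrite !edges_cat !(run_word_inv, edges_word_inv) //.
  rewrite !mem_cat !mem_rev.
  by case: (c \in edges h u); case: (c \in edges h v).
- by [].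
- by have [-> e] := IH h hr; split=> // c; rewrite e.
- have [-> e] := IH1 h hr; have [-> e'] := IH2 h hr.
  by split=> // c; rewrite e e'.
- rewrite !run_cat; have [eu e] := IHu h hr.
  have [-> e'] := IHv _ (run_reduced u hr).
  by rewrite eu; split=> // c; rewrite !edges_cat !mem_cat e e' eu.
Qed.

(** Some edge is crossed more often by the longer walk.  Both walks cross it,
    and with the same parity, so the longer one has at least two crossings more
    than the other, which has at least one. *)
Lemma shorter_crosses_thrice u w :
  vagner u w -> size u < size w -> crosses_thrice w.
Proof.
move=> uw; rewrite -(size_edges [::] u) -(size_edges [::] w) => ltuw.
have [er ee] := vagner_invariant uw (h := [::]) isT.
have [c ltc] : exists c,
    count_mem c (edges [::] u) < count_mem c (edges [::] w).
  apply: contrapT => nc.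
  have /count_subseqP[s /size_subseq ss /perm_size ws] c :
      count_mem c (edges [::] w) <= count_mem c (edges [::] u).
    by rewrite leqNgt; apply/negP => ltc; apply: nc; exists c.
  by rewrite ltnNge ws ss in ltuw.
apply: (@count_crosses_thrice c [::]) => //.
have := odd_crossings c [::] u; rewrite er -odd_crossings.
have := ee c; rewrite -!has_pred1 !has_count.
case: (count_mem c (edges [::] u)) ltc => [|[|m]].
- by case: count.
- by case: count => [|[|[|]]].
- by move=> lt _ _; apply: leq_trans lt.
Qed.

(** * Torsion-freeness of the free group *)
Definition power w n := flatten (nseq n w).

Definition free_eq u v := forall h, reduced h -> run h u = run h v.

Lemma free_eq_cat u u' v v' :
  free_eq u u' -> free_eq v v' -> free_eq (u ++ v) (u' ++ v').
Proof.
move=> eu ev h hr; rewrite !run_cat eu // ev //; exact: run_reduced.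
Qed.

Lemma free_eq_trans v u w : free_eq u v -> free_eq v w -> free_eq u w.
Proof. by move=> uv vw h hr; rewrite uv // vw. Qed.

Lemma free_eq_power u v n : free_eq u v -> free_eq (power u n) (power v n).
Proof. by move=> uv; elim: n => // n IH; apply: free_eq_cat. Qed.

(** Reduction preserves the element of the free group; the reversal turns a
    stack back into a word. *)
Lemma free_eq_nf w : free_eq w (rev (run [::] w)).
Proof.
elim/last_ind: w => // w a IH h hr; rewrite -cats1 !run_cat /= IH //.
have := run_reduced w (isT : reduced [::]).
case: (pushP (run [::] w) a) => [t ->|_] tr.
  rewrite rev_cons -cats1 run_cat /=.
  by rewrite -{2}(letter_invK a) pushK // run_reduced.
by rewrite rev_cons -cats1 run_cat.
Qed.

Lemma size_push h a : size (push h a) <= (size h).+1.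
Proof. by case: pushP => [t ->|_] //=; rewrite ltnW. Qed.

Lemma size_run h w : size (run h w) <= size h + size w.
Proof.
elim: w h => [|a w IH] h /=; first by rewrite addn0.
by rewrite (leq_trans (IH _)) // addnS -addSn leq_add2r size_push.
Qed.

(** The length of the element of the free group represented by the word. *)
Definition free_length w := size (run [::] w).

Lemma free_length_eq u v : free_eq u v -> free_length u = free_length v.
Proof. by rewrite /free_length => ->. Qed.

Lemma free_length_size w : free_length w <= size w.
Proof. by rewrite (leq_trans (size_run _ _)). Qed.

Lemma free_length_cat u v :
  free_length (u ++ v) <= free_length u + free_length v.
Proof.
rewrite /free_length run_cat (free_eq_nf v) ?run_reduced //.
by rewrite (leq_trans (size_run _ _)) // size_rev.
Qed.

Lemma free_eq_cancelr u v : free_eq (u ++ v ++ word_inv v) u.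
Proof. by move=> h hr; rewrite !run_cat run_word_inv // run_reduced. Qed.

Lemma word_invK : involutive (@word_inv X).
Proof.
move=> w; rewrite /word_inv map_rev revK -map_comp.
by rewrite (eq_map (@letter_invK X)) map_id.
Qed.

Lemma free_eq_cancell u v : free_eq (word_inv v ++ v ++ u) u.
Proof.
by move=> h hr; rewrite !run_cat -{2}(word_invK v) run_word_inv.
Qed.

Lemma run_no_cancel a h w :
  path no_cancel a w -> run (a :: h) w = rev w ++ a :: h.
Proof.
elim: w a h => //= b w IH a h /andP[ab bw].
by rewrite /push /= ifN ?IH ?rev_cons ?cat_rcons.
Qed.

Lemma size_power w n : size (power w n) = n * size w.
Proof. by elim: n => //= n IH; rewrite size_cat IH. Qed.

(** Repeating a cyclically reduced word produces no cancellation. *)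
Lemma free_length_cycle_power w n :
  cycle no_cancel w -> free_length (power w n) = size (power w n).
Proof.
case: w => [|a w] cw; first by rewrite /power; elim: n.
have: path no_cancel (last a w) (power (a :: w) n).
  elim: n => //= n IH; move: cw; rewrite /= rcons_path => /andP[aw la].
  by rewrite la cat_path aw.
case: n => // n; rewrite /free_length /= => /andP[_ pw].
by rewrite run_no_cancel // size_cat size_rev addn1.
Qed.

Lemma not_pathP a w : ~~ path no_cancel a w ->
  exists p b q, a :: w = p ++ b :: letter_inv b :: q.
Proof.
elim: w a => //= b w IH a; rewrite negb_and => /orP[/negPn/eqP ->|/IH].
  by exists [::], (letter_inv b), w; rewrite letter_invK.
by move=> [p [c [q ->]]]; exists (a :: p), c, q.
Qed.

(** A word that is not cyclically reduced has a rotation that starts with a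
    cancelling pair; a one-letter word is cyclically reduced since no letter is
    its own inverse. *)
Lemma not_cycleP w : ~~ cycle no_cancel w ->
  exists p q b s, w = p ++ q /\ q ++ p = b :: letter_inv b :: s.
Proof.
case: w => //= a w /not_pathP[p [b [q]]].
case/lastP: q => [|q c].
  rewrite -rcons_cons -cat_rcons cats1 => /rcons_inj[ew ea].
  case: p ew => [|d p] [ed ->].
    by have := letter_inv_neq b; rewrite -ea ed eqxx.
  by exists (d :: p), [:: b], b, p; rewrite cats1 -ed ea.
rewrite -!rcons_cons -rcons_cat => /rcons_inj[-> _].
by exists p, (b :: letter_inv b :: q), b, (q ++ p).
Qed.

Lemma power_shift p q n : power (q ++ p) n ++ q = q ++ power (p ++ q) n.
Proof.
elim: n => [|n IH]; first by rewrite cats0.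
by rewrite /power /= -!catA -!/(power _ n) IH.
Qed.

(** Every word is conjugate in the free group to a cyclically reduced one,
    which is reached by removing cancelling pairs from rotations.  Conjugation
    changes the lengths of all powers by a bounded amount. *)
Lemma free_length_power_unbounded w :
  free_eq w [::] \/ exists K, forall n, n <= free_length (power w n) + K.
Proof.
elim: {w}(size w) {-2}w (leqnn (size w)) => [[] // _|m IH w sw]; first by left.
have [cw|/not_cycleP[p [q [b [s [ew eqp]]]]]] := boolP (cycle no_cancel w).
  case: w {sw} cw => [|a w] cw; first by left.
  right; exists 0 => n; rewrite addn0 free_length_cycle_power // size_power.
  by rewrite leq_pmulr.
have ss : size s <= m.
  by move: sw; rewrite ew size_cat addnC -size_cat eqp => /ltnW.
have qps : free_eq (q ++ p) s by rewrite eqp => h hr /=; rewrite pushK.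
case: (IH s ss) => [s1|[K sK]]; [left|right].
  have qp1 := free_eq_trans qps s1; rewrite ew.
  apply: (@free_eq_trans ((word_inv q ++ q) ++ p ++ q)).
    by move=> h hr; rewrite -catA free_eq_cancell.
  rewrite -catA (catA q); apply: (@free_eq_trans (word_inv q ++ [::] ++ q)).
    by apply: free_eq_cat => //; apply: free_eq_cat.
  by have := @free_eq_cancell [::] q; rewrite cats0.
(* [(q ++ p)^n] is the conjugate of [w^n = (p ++ q)^n] by [q]. *)
exists (K + (size q + size q)) => n.
rewrite addnCA addnC (leq_trans (sK n)) // leq_add2r.
rewrite -(free_length_eq (free_eq_power n qps)).
rewrite -(free_length_eq (@free_eq_cancelr _ q)).
rewrite catA power_shift -ew -catA (leq_trans (free_length_cat _ _)) //.
rewrite addnCA leq_add ?free_length_size //.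
rewrite (leq_trans (free_length_cat _ _)) //.
rewrite leq_add2l (leq_trans (free_length_size _)) //.
by rewrite /word_inv size_rev size_map.
Qed.

Lemma size_run_le h w K : (forall c, c \in edges h w -> size c <= K) ->
  size h <= K -> size (run h w) <= K.
Proof.
elim: w h => //= a w IH h eK hK; apply: IH => [c cw|].
  by apply: eK; rewrite inE cw orbT.
have := eK (edge h a); rewrite inE eqxx => /(_ isT).
by case: pushP hK => // t -> /= /ltnW.
Qed.

(** Torsion-freeness in the form of a statement about walks: only an element
    trivial in the free group can be repeated forever within a ball. *)
Lemma bounded_orbit u w K :
  (forall n, size (run [::] (u ++ power w n)) <= K) -> run [::] w = [::].
Proof.
move=> uK; have [w1|[K' wK]] := free_length_power_unbounded w; first exact: w1.
have := wK (size u + K + K').+1; rewrite -addSn leq_add2r ltnNge => /negP[].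
rewrite -(free_length_eq (@free_eq_cancell _ u)).
rewrite (leq_trans (free_length_cat _ _)) //.
rewrite leq_add ?uK // (leq_trans (free_length_size _)) //.
by rewrite /word_inv size_rev size_map.
Qed.

Lemma size_edge_le h w c : c \in edges h w -> size c <= size h + size w.
Proof.
elim: w h => //= a w IH h; rewrite inE addnS -addSn => /orP[/eqP ->|/IH].
  by rewrite (leq_trans _ (leq_addr _ _)) //; case: pushP.
by move/leq_trans; apply; rewrite leq_add2r size_push.
Qed.

End CayleyTree.

(** * Idempotents and geodesics of the free inverse monoid *)
Section FIMAlgebra.
Variable X : finType.
Implicit Types (a : letter X) (p q r u v w : word X).
Local Open Scope group_scope.
Local Notation pi := (@FIM_pi X).

(** The idempotents of an inverse monoid are its elements [u * u^-1]; in this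
    form they commute by a defining relation. *)
Definition projection w := exists u, pi w = pi (u ++ word_inv u).

Lemma pi_regular u : pi u * pi (word_inv u) * pi u = pi u.
Proof. by rewrite -!FIM_pi_cat -catA; apply/FIM_piP/vagner_regular. Qed.

Lemma projectionC p q :
  projection p -> projection q -> pi p * pi q = pi q * pi p.
Proof.
move=> [u ->] [v ->]; rewrite -!FIM_pi_cat -!catA.
exact/FIM_piP/vagner_comm.
Qed.

Lemma projection_idem p : projection p -> pi p * pi p = pi p.
Proof. by move=> [u ->]; rewrite FIM_pi_cat !mulgA pi_regular. Qed.

Lemma projection_cat p q : projection p -> projection q -> projection (p ++ q).
Proof.
move=> P Q; have [u eu] := P; have [v ev] := Q.
exists (u ++ word_inv u ++ v).
have -> : (u ++ word_inv u ++ v) ++ word_inv (u ++ word_inv u ++ v) =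
    (u ++ word_inv u) ++ (v ++ word_inv v) ++ u ++ word_inv u.
  by rewrite !word_inv_cat word_invK -!catA.
rewrite !(FIM_pi_cat (_ ++ _)) -eu -ev -(projectionC P Q) mulgA.
by rewrite projection_idem // FIM_pi_cat.
Qed.

Lemma projection_conj a p :
  projection p -> projection (a :: p ++ [:: letter_inv a]).
Proof.
move=> [u eu]; exists (a :: u); rewrite word_inv_cons -cat1s !FIM_pi_cat eu.
by rewrite -(cat1s a u) !FIM_pi_cat -!mulgA.
Qed.

Lemma dyck_projection w : dyck w -> projection w.
Proof.
elim=> {w} [|a p q _ P _ Q]; first by exists [::].
by rewrite -(cat1s _ q) catA -cat_cons; apply/projection_cat/Q/projection_conj.
Qed.

Lemma FIM_pi_cons a w : pi (a :: w) = pi [:: a] * pi w.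
Proof. by rewrite -FIM_pi_cat. Qed.

(** Moving the idempotent [r] to the left of [a q a^-1] and then [a^-1 a] to the
    left of [q] gives [r a a^-1 a q]. *)
Lemma thrice_shorten a q r : dyck q -> dyck r ->
  pi (a :: q ++ letter_inv a :: r ++ [:: a]) = pi (r ++ a :: q).
Proof.
move=> /dyck_projection Q /dyck_projection R.
have A : projection [:: letter_inv a; a].
  by exists [:: letter_inv a]; rewrite /word_inv /= letter_invK.
have := projectionC Q A; have := projectionC (projection_conj a Q) R.
have reg : pi [:: a] * pi [:: letter_inv a] * pi [:: a] = pi [:: a].
  exact: (pi_regular [:: a]).
rewrite !(FIM_pi_cons _ (_ :: _), FIM_pi_cons _ (_ ++ _), FIM_pi_cat).
rewrite (FIM_pi_cons a q) => QR QA.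
have := congr1 (fun x => x * pi [:: a]) QR; rewrite -!mulgA => ->.
by rewrite QA -[in RHS]reg -!mulgA.
Qed.

Lemma not_Geo_crosses_thrice w : ~ Geo X w <-> crosses_thrice w.
Proof.
split=> [ngeo|[p [a [q [r [s [-> Q R]]]]]]].
  have [u uw ltuw] : exists2 u, vagner u w & size u < size w.
    apply: contrapT => nex; apply: ngeo; split; first by exists w.
    move=> _ [u /FIM_piP uw <-]; rewrite leqNgt; apply/negP => ltuw.
    by apply: nex; exists u.
  exact: shorter_crosses_thrice uw ltuw.
move=> [_ /(_ (size (p ++ r ++ a :: q ++ s)))].
suff e : pi (p ++ r ++ a :: q ++ s) =
    pi (p ++ a :: q ++ letter_inv a :: r ++ a :: s).
  move=> /(_ (ex_intro2 _ _ _ e erefl)).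
  do 4![rewrite ?size_cat /=]; rewrite !addnS (addnCA (size q)).
  by rewrite ltnS ltnNge leqnSn.
have := thrice_shorten a Q R.
move/(congr1 (fun x => pi p * x * pi s)); rewrite -!FIM_pi_cat /=.
by rewrite -!catA /= -!catA /= -!catA /=.
Qed.

(** * Triviality of the relation H *)
Lemma green_R_factor (M : monoidType) (x y : M) :
  green_R x y -> exists z, x = y * z.
Proof.
move=> e; have [z _ <-] : range (fun z => y * z) x; last by exists z.
by rewrite -e; exists 1 => //; rewrite mulg1.
Qed.

Lemma green_L_factor (M : monoidType) (x y : M) :
  green_L x y -> exists z, x = z * y.
Proof.
move=> e; have [z _ <-] : range (fun z => z * y) x; last by exists z.
by rewrite -e; exists 1 => //; rewrite mul1g.
Qed.

Lemma FIM_pi_power w n : pi (power w n) = pi w ^+ n.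
Proof. by elim: n => // n IH; rewrite expgS -IH -FIM_pi_cat. Qed.

(** Iterating the hypotheses gives [x = x w^n y^n] for all [n], so the walk of
    [x w^n] is part of a walk with the same tree as [x]: its endpoint stays at
    bounded distance from the root. *)
Lemma stable_projection (x y t : FIM X) w :
  x = x * pi w * y -> x * pi w = t * x -> projection w.
Proof.
have [u <-] := FIM_pi_surj x; have [v <-] := FIM_pi_surj y => xwy xwt.
have xn n : pi u = pi (u ++ power w n ++ power v n).
  rewrite !FIM_pi_cat !FIM_pi_power.
  elim: n => [|n IH]; first by rewrite !mulg1.
  rewrite expgS expgSr !mulgA xwt -(mulgA t) -(mulgA t) -(mulgA (pi u)) -IH.
  by rewrite -xwt.
apply/dyck_projection/(@closed_dyck _ [::]) => //.
apply: (@bounded_orbit _ u w (size u)) => n; apply: size_run_le => // c cw.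
have /FIM_piP/vagner_invariant/(_ [::] isT)[_ e] := xn n.
apply: (@size_edge_le _ [::] u).
by rewrite e catA edges_cat mem_cat cw.
Qed.

Lemma green_H_FIM (x y : FIM X) : green_H x y <-> x = y.
Proof.
split=> [[L R]|-> //]; have [z xyz] := green_R_factor R.
have [z' yxz] := green_R_factor (esym R).
have [t yt] := green_L_factor (esym L); have [t' xt] := green_L_factor L.
have [v ev] := FIM_pi_surj z; have [w ew] := FIM_pi_surj z'; subst z z'.
have W : projection w.
  by apply: (@stable_projection x (pi v) t); rewrite -yxz.
have V : projection v.
  by apply: (@stable_projection y (pi w) t'); rewrite -xyz.
(* [y = x w = (x w v) w = x (w w) v = (x w) v = x], as [x = y v = x w v]. *)
rewrite [RHS]yxz {2}xyz yxz -2!mulgA (projectionC V W) (mulgA (pi w)).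
by rewrite (projection_idem W) mulgA -yxz.
Qed.

Lemma HGeo_Geo : HGeo X = Geo X.
Proof.
have HP w : [set u : word X | green_H (pi u) (pi w)]%classic
    = [set u : word X | pi u = pi w]%classic.
  by apply: eq_set => u; apply/propext/green_H_FIM.
by apply: eq_set => w; rewrite HP.
Qed.

End FIMAlgebra.

(** * Soundness and derivations for context-free grammars *)
Section ContextFree.
Variable T : finType.
Implicit Types (G : cfg T) (w : seq T).

(** The language of a sentential form when each nonterminal [A] stands for the
    language [L A]. *)
Fixpoint form_lang (N : Type) (L : N -> seq T -> Prop) (f : seq (N + T)) w :=
  match f with
  | [::] => w = [::]
  | inr a :: f' => exists2 w', w = a :: w' & form_lang L f' w'
  | inl A :: f' => exists u v, [/\ w = u ++ v, L A u & form_lang L f' v]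
  end.

Lemma form_lang_cat N (L : N -> seq T -> Prop) f g w :
  form_lang L (f ++ g) w <->
  exists u v, [/\ w = u ++ v, form_lang L f u & form_lang L g v].
Proof.
elim: f w => [|[A|a] f IH] w /=.
- by split=> [gw|[u [v [-> -> ]]] //]; exists [::], w.
- split=> [[u [v [-> Au /IH[v1 [v2 [-> fv gv]]]]]]|].
    by exists (u ++ v1), v2; split; rewrite ?catA //; exists u, v1.
  move=> [u [v [-> [u1 [u2 [-> Au fu]]] gv]]]; exists u1, (u2 ++ v).
  by rewrite catA; split=> //; apply/IH; exists u2, v.
- split=> [[v -> /IH[v1 [v2 [-> fv gv]]]]|].
    by exists (a :: v1), v2; split=> //; exists v1.
  move=> [u [v [-> [u1 -> fu] gv]]]; exists (u1 ++ v) => //.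
  by apply/IH; exists u1, v.
Qed.

Lemma form_lang_terminal N (L : N -> seq T -> Prop) w :
  form_lang L (map inr w) w.
Proof. by elim: w => //= a w IH; exists w. Qed.

(** The generated languages are the least solution of the system of inclusions
    given by the rules. *)
Lemma cfg_lang_sound G (L : cfg_nonterm G -> seq T -> Prop) :
  (forall A f w, (A, f) \in cfg_rules G -> form_lang L f w -> L A w) ->
  forall w, cfg_lang G w -> L (cfg_start G) w.
Proof.
move=> closedL w; rewrite /cfg_lang /= => dw.
suff: form_lang L [:: inl (cfg_start G)] w.
  by move=> [u [v [-> Lu /= ->]]]; rewrite cats0.
move: dw (form_lang_terminal L w).
move: [:: inl _] (map _ _) => f g.
elim=> {f g} [_ _ [l r A rhs Arhs]|//|f g h _ IH1 _ IH2 hw].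
  move=> /form_lang_cat[u [v [-> lu /form_lang_cat[v1 [v2 [-> rv1 rv2]]]]]].
  apply/form_lang_cat; exists u, (v1 ++ v2); split=> //.
  by exists v1, v2; split=> //; apply: closedL rv1.
exact: IH1 (IH2 hw).
Qed.

Definition derives G := clos_refl_trans _ (@cfg_step T G).

Lemma derives_context G l f g r :
  derives f g -> @derives G (l ++ f ++ r) (l ++ g ++ r).
Proof.
elim=> {f g} [_ _ [l' r' A rhs Arhs]|f|f g h _ IH1 _ IH2].
- rewrite -!catA cat_cons !(catA l).
  by apply: rt_step; apply: CfgStep.
- exact: rt_refl.
- exact: rt_trans IH1 IH2.
Qed.

Lemma derives_cat G f f' g g' :
  derives f f' -> derives g g' -> @derives G (f ++ g) (f' ++ g').
Proof.
move=> ff' gg'; apply: (@rt_trans _ _ _ (f' ++ g)).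
  exact: (derives_context [::] g ff').
by have := derives_context f' [::] gg'; rewrite !cats0.
Qed.

Lemma derives_cons G (s : cfg_nonterm G + T) f g :
  derives f g -> derives (s :: f) (s :: g).
Proof. exact: derives_cat (rt_refl _ _ [:: s]). Qed.

Lemma derives_rule G A f g :
  (A, f) \in cfg_rules G -> derives f g -> @derives G [:: inl A] g.
Proof.
move=> Af; apply: rt_trans; rewrite -[f]cats0 -[f ++ _]cat0s.
by apply: rt_step; apply: (CfgStep [::] [::]).
Qed.

End ContextFree.

(** * A grammar for the words that are not geodesic *)
Inductive nonterm := Start | Loop | Any.

Definition nonterm_code (A : nonterm) : 'I_3 :=
  match A with Start => inord 0 | Loop => inord 1 | Any => inord 2 end.

Definition nonterm_decode (i : 'I_3) : nonterm :=
  match val i with 0 => Start | 1 => Loop | _ => Any end.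

Lemma nonterm_codeK : cancel nonterm_code nonterm_decode.
Proof. by case; rewrite /nonterm_decode /= inordK. Qed.

HB.instance Definition _ := Finite.copy nonterm (can_type nonterm_codeK).

Section Grammar.
Variable X : finType.
Implicit Types (a : letter X) (p q r u v w : word X).

Definition start_rule a : nonterm * seq (nonterm + letter X) :=
  (Start, [:: inl Any; inr a; inl Loop; inr (letter_inv a); inl Loop; inr a;
              inl Any]).
Definition loop_rule a : nonterm * seq (nonterm + letter X) :=
  (Loop, [:: inr a; inl Loop; inr (letter_inv a); inl Loop]).
Definition any_rule a : nonterm * seq (nonterm + letter X) :=
  (Any, [:: inr a; inl Any]).

Definition grammar : cfg (letter X) :=
  @Cfg _ nonterm Start
    ((Loop, [::]) :: (Any, [::]) ::
     map start_rule (enum {: letter X}) ++ map loop_rule (enum {: letter X})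
      ++ map any_rule (enum {: letter X})).

Definition nonterm_spec (A : nonterm) w :=
  match A with Start => crosses_thrice w | Loop => dyck w | Any => True end.

Lemma grammar_sound w : cfg_lang grammar w -> crosses_thrice w.
Proof.
move/(@cfg_lang_sound _ grammar nonterm_spec); apply=> A f {}w.
rewrite /= !inE !mem_cat => /or4P[/eqP[-> ->] ->|/eqP[-> ->] //||].
- exact: dyck_nil.
- move=> /mapP[a _ [-> ->]] /=.
  move=> [p [? [-> _ [? -> [q [? [-> dq [? -> [r [? [-> dr [? ->]]]]]]]]]]]].
  by move=> [s [? [-> _ ->]]]; exists p, a, q, r, s; rewrite cats0.
case/orP=> /mapP[a _ [-> ->]] //=.
move=> [? -> [p [? [-> dp [? -> [q [? [-> dq ->]]]]]]]].
by rewrite cats0; apply: dyck_cons.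
Qed.

Definition produces (A : nonterm) w :=
  @derives _ grammar [:: inl A] (map inr w).

Lemma derives_dyck w : dyck w -> produces Loop w.
Proof.
elim=> {w} [|a p q _ IHp _ IHq].
  apply: (@derives_rule _ grammar _ [::]) (rt_refl _ _ _).
  by rewrite /= inE eqxx.
apply: (@derives_rule _ grammar _ (loop_rule a).2).
  by rewrite /= !inE !mem_cat (map_f loop_rule) ?mem_enum // !orbT.
rewrite /= map_cat /=; apply/derives_cons/(derives_cat IHp).
exact: derives_cons IHq.
Qed.

Lemma derives_any w : produces Any w.
Proof.
elim: w => [|a w IH].
  apply: (@derives_rule _ grammar _ [::]) (rt_refl _ _ _).
  by rewrite /= !inE eqxx orbT.
apply: (@derives_rule _ grammar _ (any_rule a).2).
  by rewrite /= !inE !mem_cat (map_f any_rule) ?mem_enum // !orbT.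
exact: derives_cons IH.
Qed.

Lemma grammar_complete w : crosses_thrice w -> cfg_lang grammar w.
Proof.
move=> [p [a [q [r [s [-> dq dr]]]]]].
apply: (@derives_rule _ grammar _ (start_rule a).2).
  by rewrite /= !inE !mem_cat (map_f start_rule) ?mem_enum // !orbT.
rewrite map_cat /= map_cat /= map_cat /=.
apply/(derives_cat (derives_any p))/derives_cons.
apply/(derives_cat (derives_dyck dq))/derives_cons.
apply/(derives_cat (derives_dyck dr))/derives_cons.
exact: derives_any.
Qed.

End Grammar.

Theorem theorem6p3 (X : finType) :
  HGeo X = Geo X /\ co_context_free (Geo X).
Proof.
split; first exact: HGeo_Geo.
exists (grammar X); apply/seteqP; split=> w.
  by move/grammar_sound/not_Geo_crosses_thrice.
by move/not_Geo_crosses_thrice/grammar_complete.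
Qed.
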